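(* Let $\{\mathbf{x}(t)\}_{t\ge0}$ be generated by the multiagent distributed ADMM algorithm described in the context with penalty parameter $c>0$, starting from $\mathbf{x}(0)=0$ and using the standard graph Laplacian as the communication matrix, and for $T\ge1$ let $\hat{\mathbf{x}}(T)=\frac1T\sum_{t=1}^T\mathbf{x}(t)$. Let $U$ be a bound on the subgradients of $F$ at $\mathbf{x}^*$, i.e. $\|\mathbf{v}\|_2\le U$ for all $\mathbf{v}\in\partial F(\mathbf{x}^* )$, and let $a(G)$ be the algebraic connectivity of the graph. Then for any integer $T\ge1$, $$|F(\hat{\mathbf{x}}(T))-F(\mathbf{x}^* )|\le\frac{c}{2T}\|\mathbf{x}^*\|_2^2\left(4d_{\max}^2\right)+\frac{2}{cT}U^2\,\frac{2d_{\max}}{a(G)^2},$$ and $$\|Q\hat{\mathbf{x}}(T)\|_2\le\frac1{2T}\|\mathbf{x}^*\|_2^2\left(4d_{\max}^2\right)+\frac1{2T}\left(2+\frac{2U^2}{c^2}\,\frac{2d_{\max}}{a(G)^2}\right).$$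
   Context: Setting. Let $n\ge 2$ and let $G=(V,E)$ be a connected undirected simple graph with $V=\{1,\dots,n\}$. $N(i)$ is the set of neighbors of $i$ together with $i$ itself, $d_i=|N(i)|-1$ is the degree of $i$, and $d_{\max}=\max_id_i$. For each $i$, $f_i:\mathbb{R}\to\mathbb{R}$ is convex (the paper takes dimension one for notational simplicity), and $F(\mathbf{x})=\sum_{i=1}^n f_i(x_i)$ for $\mathbf{x}=(x_1,\dots,x_n)\in\mathbb{R}^n$; $\partial F(\mathbf{x})=\{(h_1,\dots,h_n): h_i\in\partial f_i(x_i)\}$ is its subdifferential. The communication matrix is the Laplacian $A$ of $G$: $A_{ij}=-1$ for $j\in N(i)\setminus\{i\}$, $A_{ii}=d_i$, and $A_{ij}=0$ otherwise. $a(G)$ is the smallest non-zero eigenvalue of $A$. The problem $\min\{F(\mathbf{x}): A\mathbf{x}=0\}$ is assumed to have an optimal solution; $\mathbf{x}^*$ denotes one. Prime denotes transpose. $D$ is the diagonal matrix with $D_{ii}=d_i+1$, and $Q=(A'D^{-1}A)^{1/2}$ is the symmetric positive semidefinite square root. Algorithm (penalty parameter $c>0$). Start from $\mathbf{x}(0)\in\mathbb{R}^n$, $y_i(0)=\frac{1}{d_i+1}\sum_{j\in N(i)}A_{ij}x_j(0)$, $p_i(0)=c\,y_i(0)$. For $t=0,1,2,\dots$ and all $i$: (1) $x_i(t+1)\in\arg\min_{x_i\in\mathbb{R}} f_i(x_i)+\sum_{j\in N(i)}\left(p_j(t)A_{ji}x_i+\frac c2\left|y_j(t)+A_{ji}(x_i-x_i(t))\right|^2\right)$;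 (2) $y_i(t+1)=\frac{1}{d_i+1}\sum_{j\in N(i)}A_{ij}x_j(t+1)$; (3) $p_i(t+1)=p_i(t)+c\,y_i(t+1)$. *)

(* Defs.v *)
From mathcomp Require Export all_boot all_order all_algebra.
From mathcomp Require Export classical_sets reals convex.

Set Implicit Arguments.
Unset Strict Implicit.
Unset Printing Implicit Defensive.

Import Order.TTheory GRing.Theory Num.Theory.
Local Open Scope ring_scope.

(* A graph on {0, ..., n-1} is given by its adjacency relation e; that e is
   symmetric, irreflexive and connected is assumed where needed. *)
Section Graph.
Variables (n : nat) (e : rel 'I_n).

(* Closed neighborhood: i itself is included. *)
Definition closed_nbr (i : 'I_n) : {set 'I_n} :=
  [set j | (j == i) || e i j]%SET.

Definition degree (i : 'I_n) : nat := #|closed_nbr i|.-1.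

Definition max_degree : nat := \max_(i < n) degree i.

Definition graph_connected : Prop := forall i j : 'I_n, connect e i j.

Definition laplacian (R : realType) : 'M[R]_n :=
  \matrix_(i, j) (if j == i then (degree i)%:R
                  else if j \in closed_nbr i then -1 else 0).

Definition degree_succ_mx (R : realType) : 'M[R]_n :=
  diag_mx (\row_i (degree i).+1%:R).

Definition is_algebraic_connectivity (R : realType) (a : R) : Prop :=
  [/\ eigenvalue (laplacian R) a, a != 0 &
      forall b : R, eigenvalue (laplacian R) b -> b != 0 -> a <= b].

End Graph.

Section Analysis.
Variable R : realType.

(* The norm that the library attaches to matrices is the sup norm. *)
Definition l2norm (n : nat) (v : 'cV[R]_n) : R :=
  Num.sqrt (\sum_(i < n) v i 0 ^+ 2).

Definition is_psd (n : nat) (M : 'M[R]_n) : Prop :=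
  M^T = M /\ forall v : 'cV[R]_n, 0 <= (v^T *m M *m v) 0 0.

(* Q = M^(1/2), for M symmetric positive semidefinite; such a Q exists and is
   unique. *)
Definition is_psd_sqrt (n : nat) (Q M : 'M[R]_n) : Prop :=
  is_psd Q /\ Q *m Q = M.

Definition convex_on_line (g : R -> R) : Prop :=
  convex_function (@setT R^o) g.

Definition subdifferential (g : R -> R) (u : R) : set R :=
  [set h | forall w : R, g u + h * (w - u) <= g w]%classic.

Definition argmin (g : R -> R) : set R :=
  [set u | forall w : R, g u <= g w]%classic.

Definition objective (n : nat) (f : 'I_n -> R -> R) (x : 'cV[R]_n) : R :=
  \sum_(i < n) f i (x i 0).

Definition objective_subdifferential (n : nat) (f : 'I_n -> R -> R)
    (x : 'cV[R]_n) : set 'cV[R]_n :=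
  [set v | forall i, subdifferential (f i) (x i 0) (v i 0)]%classic.

Definition is_optimal (n : nat) (f : 'I_n -> R -> R) (A : 'M[R]_n)
    (xstar : 'cV[R]_n) : Prop :=
  A *m xstar = 0 /\
  forall x : 'cV[R]_n, A *m x = 0 -> objective f xstar <= objective f x.

Section Admm.
Variables (n : nat) (e : rel 'I_n) (f : 'I_n -> R -> R) (c : R).

Local Notation A := (laplacian e R).

Definition local_lagrangian (xt yt pt : 'cV[R]_n) (i : 'I_n) (u : R) : R :=
  f i u + \sum_(j in closed_nbr e i)
            (pt j 0 * A j i * u
             + c / 2 * `|yt j 0 + A j i * (u - xt i 0)| ^+ 2).

Definition local_average (xt : 'cV[R]_n) (i : 'I_n) : R :=
  ((degree e i).+1%:R)^-1 * \sum_(j in closed_nbr e i) A i j * xt j 0.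

(* The x-update may select any element of the argmin set. *)
Record admm_run (x y p : nat -> 'cV[R]_n) : Prop := {
  admm_y0 : forall i, y 0 i 0 = local_average (x 0) i;
  admm_p0 : forall i, p 0 i 0 = c * y 0 i 0;
  admm_x : forall t i,
    argmin (local_lagrangian (x t) (y t) (p t) i) (x t.+1 i 0);
  admm_y : forall t i, y t.+1 i 0 = local_average (x t.+1) i;
  admm_p : forall t i, p t.+1 i 0 = p t i 0 + c * y t.+1 i 0
}.

End Admm.

Definition ergodic_average (n : nat) (x : nat -> 'cV[R]_n) (T : nat)
    : 'cV[R]_n :=
  T%:R^-1 *: \sum_(1 <= t < T.+1) x t.

End Analysis.

(* Main.v *)
Require Import Defs.
From mathcomp Require Import spectral sesquilinear interval_inference complex.
From mathcomp Require Import ring lra.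

(** The proof is the standard O(1/T) analysis of ADMM, read off a single
Lyapunov function. Write F* for the optimal value and B = A' D^-1 A = Q^2, let M
be the diagonal matrix with entries d_i (d_i + 1), which are the sums of squares
of the columns of A, and put W = M - B. Cauchy-Schwarz on each closed
neighborhood shows that W is positive semidefinite ([prox_mx_ge0]).

Differentiating the quadratic part of each local problem and using
p(t) = c D^-1 A (x(0) + ... + x(t)), one finds ([run_subgradient]) the
subgradient - c (Q r(t+1) + W (x(t+1) - x(t))) of F at x(t+1), where
r(t) = Q (x(0) + ... + x(t)). So the algorithm is a proximal iteration in which
r plays the part of the multiplier. The subgradient inequality against x*, with
Q x* = 0 and Q x(t+1) = r(t+1) - r(t), shows that for every vector r the
quantity |r(t) - r|^2 + |x(t) - x*|_W^2 decreases at each step by at least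
2/c times F(x(t+1)) - F* + c r' Q x(t+1) ([lyapunov_step]). Summing from
x(0) = 0 and averaging by convexity gives, for every r ([ergodic_gap]),

  F(xhat) - F* + c r' Q xhat <= c / (2 T) (|r|^2 + |x*|_W^2).

Conversely, if - c Q r* is a subgradient of F at x*, the left-hand side is
nonnegative for r = r* ([saddle_lower]). Taking r = 0 and r = 2 r* bounds
F(xhat) - F* from above and below, and r = r* + Q xhat / |Q xhat| bounds
|Q xhat| ([saddle_rates]). As A x* = 0, |x*|_W^2 = |x*|_M^2 is at most
2 d_max^2 |x*|^2.

It remains to find r* with |r*|^2 <= 2 d_max U^2 / (c a(G))^2. The graph being
connected, A x = 0 means that x is constant, so the coordinate of x* minimizes
the sum of the f_i on the line, and the sum rule for subdifferentials yields a
subgradient v of F at x* whose entries add up to zero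
([optimal_subgradient]). Such a v is in the image of A; solving B u = v and
taking r* = - Q u / c gives |r*|^2 = u' v / c^2, which is controlled by the
smallest nonzero eigenvalue of A ([weighted_laplacian_preimage]). That
eigenvalue enters through the spectral theorem ([spectral_gap]). *)

Import Order.TTheory GRing.Theory Num.Theory.
Local Open Scope ring_scope.

Set Implicit Arguments.
Unset Strict Implicit.
Unset Printing Implicit Defensive.

(** * Convex functions on the line *)

Section Convex.
Variable R : realType.
Implicit Types (g : R -> R).

Lemma convex_on_line_le g (u w s : R) : convex_on_line g -> 0 <= s <= 1 ->
  g (u + s * (w - u)) <= g u + s * (g w - g u).
Proof.
move=> g_cvx /andP[s0 s1].
have := g_cvx (Itv01 s0 s1) w u; rewrite !inE => /(_ I I) H.
have -> : u + s * (w - u) = s * w + (1 - s) * u by ring.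
have -> : g u + s * (g w - g u) = s * g w + (1 - s) * g u by ring.
exact: H.
Qed.

(** Stands in for letting s tend to 0 from the right. *)
Lemma ge0_of_affine_ge0 (a b : R) :
  (forall s : R, 0 < s -> s <= 1 -> 0 <= a + s * b) -> 0 <= a.
Proof.
move=> H; case: (lerP 0 a) => // a_lt0.
have b_gt0 : 0 < b by have := H 1 ltr01 (lexx 1); lra.
have s_gt0 : 0 < - a / (2 * b) by rewrite divr_gt0 ?mulr_gt0 // oppr_gt0.
have s_le1 : - a / (2 * b) <= 1.
  by rewrite ler_pdivrMr ?mulr_gt0 // mul1r; have := H 1 ltr01 (lexx 1); lra.
have := H _ s_gt0 s_le1.
have -> : - a / (2 * b) * b = - a / 2 by field; rewrite gt_eqF.
by move=> ?; lra.
Qed.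

(** Minimality is tested on the segment from u to w only. Convexity bounds the
increment of g there by s (g w - g u), and the quadratic term is of order s^2,
so it disappears after division by s. *)
Lemma subdifferential_of_argmin g (q : R -> R) (u b k : R) : convex_on_line g ->
  (forall w, q w = q u + b * (w - u) + k * (w - u) ^+ 2) ->
  argmin (fun w => g w + q w) u -> subdifferential g u (- b).
Proof.
move=> g_cvx qE umin w.
suff : 0 <= (g w - g u + b * (w - u)) by lra.
apply: (@ge0_of_affine_ge0 _ (k * (w - u) ^+ 2)) => s s_gt0 s_le1.
have := umin (u + s * (w - u)); rewrite /= (qE (u + _)).
have := convex_on_line_le u w g_cvx (_ : 0 <= s <= 1).
rewrite (ltW s_gt0) s_le1 => /(_ isT) H1 H2.
rewrite -(pmulr_rge0 _ s_gt0).
have -> : s * (g w - g u + b * (w - u) + s * (k * (w - u) ^+ 2)) =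
  s * (g w - g u) + b * (u + s * (w - u) - u) + k * (u + s * (w - u) - u) ^+ 2 by ring.
lra.
Qed.

(** The point u divides the segment from u - r to u + s in the ratio r : s. *)
Lemma convex_slope_le g (u r s : R) : convex_on_line g -> 0 < r -> 0 < s ->
  (g u - g (u - r)) / r <= (g (u + s) - g u) / s.
Proof.
move=> g_cvx r0 s0; have rs0 : 0 < r + s by rewrite addr_gt0.
have := @convex_on_line_le g (u - r) (u + s) (r / (r + s)) g_cvx.
have t0 : 0 <= r / (r + s) by rewrite divr_ge0 // ltW.
have t1 : r / (r + s) <= 1 by rewrite ler_pdivrMr // mul1r lerDl ltW.
rewrite t0 t1 => /(_ isT).
have -> : u - r + r / (r + s) * (u + s - (u - r)) = u by field; rewrite gt_eqF.
have -> : g (u - r) + r / (r + s) * (g (u + s) - g (u - r)) =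
   (g (u - r) * s + r * g (u + s)) / (r + s) by field; rewrite gt_eqF.
rewrite ler_pdivlMr // ler_pdivrMr // mulrAC ler_pdivlMr //; nra.
Qed.

(** The subgradient h is the right derivative, the infimum of the slopes to the
right. The estimate says that it is the largest subgradient, in a form that
can be summed over several functions. *)
Lemma right_derivative_subgradient g (u : R) : convex_on_line g ->
  exists2 h, subdifferential g u h &
    forall eps : R, 0 < eps -> exists2 d : R, 0 < d &
      forall s : R, 0 < s <= d -> g (u + s) <= g u + s * (h + eps).
Proof.
move=> g_cvx.
pose S := [set h : R | exists2 s : R, 0 < s & h = (g (u + s) - g u) / s]%classic.
have Sne : nonempty S by exists ((g (u + 1) - g u) / 1); exists 1.
have lbS r : 0 < r -> lbound S ((g u - g (u - r)) / r).
  by move=> r0 _ [s s0 ->]; exact: convex_slope_le.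
have Sinf : has_inf S by split=> //; exists ((g u - g (u - 1)) / 1); exact: lbS.
exists (inf S) => [w|eps eps0].
- have [wu|uw|->] := ltgtP w u; last by rewrite subrr mulr0 addr0.
  + have uw0 : 0 < u - w by rewrite subr_gt0.
    have := lb_le_inf Sne (lbS _ uw0).
    by rewrite ler_pdivrMr // subKr; lra.
  + have wu0 : 0 < w - u by rewrite subr_gt0.
    have : inf S <= (g w - g u) / (w - u).
      apply: ge_inf; first by case: Sinf.
      by exists (w - u) => //; rewrite subrKC.
    by rewrite ler_pdivlMr //; lra.
- have [_ [d d0 ->] Hd] := inf_adherent eps0 Sinf.
  exists d => // s /andP[s0 sd].
  have := convex_on_line_le u (u + d) g_cvx (_ : 0 <= s / d <= 1).
  rewrite divr_ge0 ?(ltW s0) ?(ltW d0) //= ler_pdivrMr // mul1r => /(_ sd).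
  have -> : u + s / d * (u + d - u) = u + s by field; rewrite gt_eqF.
  move/le_trans; apply; rewrite lerD2l -mulrA ler_pM2l // mulrC.
  exact: ltW.
Qed.

(** Mirror image, through the convex function w |-> g (- w). *)
Lemma left_derivative_subgradient g (u : R) : convex_on_line g ->
  exists2 h, subdifferential g u h &
    forall eps : R, 0 < eps -> exists2 d : R, 0 < d &
      forall s : R, 0 < s <= d -> g (u - s) <= g u - s * (h - eps).
Proof.
move=> g_cvx.
have gN_cvx : convex_on_line (g \o -%R).
  move=> t x y _ _ /=; have := g_cvx t (- x) (- y); rewrite !inE => /(_ I I).
  by rewrite /conv /= !scalerN -opprD.
have [h hsub hder] := right_derivative_subgradient (- u) gN_cvx.
exists (- h) => [w|eps eps0].
  by have := hsub (- w); rewrite /= !opprK; lra.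
have [d d0 Hd] := hder _ eps0; exists d => // s sd.
by have := Hd s sd; rewrite /= opprD !opprK; lra.
Qed.

Lemma uniform_threshold (I : finType) (P : I -> R -> Prop) :
  (forall i, exists2 d : R, 0 < d & forall s : R, 0 < s <= d -> P i s) ->
  exists2 s : R, 0 < s & forall i, P i s.
Proof.
move=> H; have /boolp.choice [d Hd] :
    forall i, exists d : R, 0 < d /\ forall s : R, 0 < s <= d -> P i s.
  by move=> i; have [d] := H i; exists d.
exists (\big[Num.min/1]_i d i) => [|i].
  by apply/bigmin_gtP; split => // i _; case: (Hd i).
case: (Hd i) => _; apply; rewrite bigmin_le // andbT.
by apply/bigmin_gtP; split => // j _; case: (Hd j).
Qed.

(** At a minimizer of the sum, the right derivatives have a nonnegative sum and
the left derivatives a nonpositive one; both are subgradients, and one convex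
combination of the two families, with the same weight for all indices, has sum
zero. *)
Lemma subdifferential_sum_rule (I : finType) (f : I -> R -> R) (u : R) :
  (forall i, convex_on_line (f i)) ->
  argmin (fun w => \sum_i f i w) u ->
  exists2 h : I -> R, forall i, subdifferential (f i) u (h i) & \sum_i h i = 0.
Proof.
move=> f_cvx umin.
have /boolp.choice[a Ha] : forall i, exists h, subdifferential (f i) u h /\
    forall eps : R, 0 < eps -> exists2 d : R, 0 < d &
      forall s : R, 0 < s <= d -> f i (u + s) <= f i u + s * (h + eps).
  by move=> i; have [h] := right_derivative_subgradient u (f_cvx i); exists h.
have /boolp.choice[b Hb] : forall i, exists h, subdifferential (f i) u h /\
    forall eps : R, 0 < eps -> exists2 d : R, 0 < d &
      forall s : R, 0 < s <= d -> f i (u - s) <= f i u - s * (h - eps).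
  by move=> i; have [h] := left_derivative_subgradient u (f_cvx i); exists h.
have a_ge0 : 0 <= \sum_i a i.
  apply: (@ge0_of_affine_ge0 _ #|I|%:R) => eps eps0 _.
  have [s s0 Hs] := uniform_threshold (fun i => (Ha i).2 _ eps0).
  have := umin (u + s); rewrite /= => H.
  have := le_trans H (ler_sum _ (fun i _ => Hs i)).
  rewrite big_split /= -mulr_sumr big_split /= sumr_const -(mulr_natr eps).
  by rewrite lerDl pmulr_rge0.
have b_le0 : \sum_i b i <= 0.
  rewrite -oppr_ge0; apply: (@ge0_of_affine_ge0 _ #|I|%:R) => eps eps0 _.
  have [s s0 Hs] := uniform_threshold (fun i => (Hb i).2 _ eps0).
  have := umin (u - s); rewrite /= => H.
  have := le_trans H (ler_sum _ (fun i _ => Hs i)).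
  rewrite sumrB -mulr_sumr sumrB /= sumr_const -(mulr_natr eps).
  by rewrite lerDl oppr_ge0 pmulr_rle0 // -oppr_ge0 opprB addrC.
(* The weight is chosen to make the affine function of t below vanish. *)
have [t t01 tE] : exists2 t, 0 <= t <= 1 &
    t * \sum_i a i + (1 - t) * \sum_i b i = 0.
  set A := \sum_i a i in a_ge0 *; set B := \sum_i b i in b_le0 *.
  have [AB0|AB0] := eqVneq (A - B) 0.
    by exists 0; [rewrite lexx ler01|]; lra.
  have AB_gt0 : 0 < A - B by rewrite lt_neqAle eq_sym AB0; lra.
  exists (- B / (A - B)); last by field.
  by rewrite divr_ge0 ?ler_pdivrMr //; lra.
exists (fun i => t * a i + (1 - t) * b i) => [i w|].
  by have := (Ha i).1 w; have := (Hb i).1 w; case/andP: t01; nra.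
by rewrite big_split /= -!mulr_sumr.
Qed.

End Convex.

(** * Inner product and spectral bound *)

Section Dot.
Variable R : realType.

Definition dot n (u v : 'cV[R]_n) : R := (u^T *m v) 0 0.

Variable n : nat.
Implicit Types (u v w : 'cV[R]_n) (M : 'M[R]_n).

Lemma dotE u v : dot u v = \sum_i u i 0 * v i 0.
Proof. by rewrite /dot mxE; apply: eq_bigr => i _; rewrite mxE. Qed.

Lemma dotC u v : dot u v = dot v u.
Proof. by rewrite !dotE; apply: eq_bigr => i _; rewrite mulrC. Qed.

Lemma dotDl u v w : dot (u + v) w = dot u w + dot v w.
Proof. by rewrite /dot linearD mulmxDl mxE. Qed.

Lemma dotNl u w : dot (- u) w = - dot u w.
Proof. by rewrite /dot linearN mulNmx mxE. Qed.

Lemma dotZl (k : R) u w : dot (k *: u) w = k * dot u w.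
Proof. by rewrite /dot linearZ -scalemxAl mxE. Qed.

Lemma dotDr u v w : dot w (u + v) = dot w u + dot w v.
Proof. by rewrite !(dotC w) dotDl. Qed.

Lemma dotNr u w : dot w (- u) = - dot w u.
Proof. by rewrite !(dotC w) dotNl. Qed.

Lemma dotZr (k : R) u w : dot w (k *: u) = k * dot w u.
Proof. by rewrite !(dotC w) dotZl. Qed.

Lemma dot0l w : dot 0 w = 0.
Proof. by rewrite /dot trmx0 mul0mx mxE. Qed.

Lemma dot0r w : dot w 0 = 0.
Proof. by rewrite dotC dot0l. Qed.

Lemma dot_mulmxr M u v : dot u (M *m v) = dot (M^T *m u) v.
Proof. by rewrite /dot trmx_mul trmxK mulmxA. Qed.

Lemma dot_ge0 u : 0 <= dot u u.
Proof. by rewrite dotE; apply: sumr_ge0 => i _; rewrite -expr2 sqr_ge0. Qed.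

Lemma dot_eq0 u : dot u u = 0 -> u = 0.
Proof.
rewrite dotE => /eqP; rewrite psumr_eq0 => [/allP u0|i _]; last first.
  by rewrite -expr2 sqr_ge0.
apply/colP => i; rewrite mxE; apply/eqP.
by have := u0 i (mem_index_enum i); rewrite mulf_eq0 orbb.
Qed.

Lemma l2norm_ge0 u : 0 <= l2norm u.
Proof. exact: sqrtr_ge0. Qed.

Lemma l2norm_sqr u : l2norm u ^+ 2 = dot u u.
Proof.
rewrite sqr_sqrtr; first by rewrite dotE; apply: eq_bigr.
by apply: sumr_ge0 => i _; exact: sqr_ge0.
Qed.

End Dot.

(** The eigenvalues of a real symmetric matrix are first found among the complex
numbers, where its characteristic polynomial splits: a unitary S satisfies
S M = diag d S, where the entries of d are real eigenvalues of M. *)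
Section Spectral.
Variables (R : realType) (n : nat) (M : 'M[R]_n).
Local Open Scope sesquilinear_scope.
Local Notation toC := (real_complex R).
Local Notation cplx := (map_mx toC).
Hypothesis M_sym : M^T = M.

Let MC : 'M[R[i]]_n := cplx M.
Let S := spectralmx MC.
Let d := spectral_diag MC.

Lemma conj_real_mx m (v : 'cV[R]_m) : map_mx Num.Def.conjC (cplx v) = cplx v.
Proof.
apply/matrixP => i j; rewrite !mxE; apply/CrealP.
by apply/complex_realP; exists (v i j).
Qed.

Lemma symmetric_hermsymmx : MC \is hermsymmx.
Proof.
apply: realsym_hermsym.
  by apply/is_hermitianmxP; rewrite expr0 scale1r map_mx_id // /MC map_trmx M_sym.
by apply/mxOverP => i j; rewrite mxE; apply/complex_realP; exists (M i j).
Qed.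

Lemma spectralE : S *m MC = diag_mx d *m S.
Proof.
have /orthomx_spectralP E := hermitian_normalmx symmetric_hermsymmx.
by rewrite {1}E !mulmxA mulmxV ?mul1mx // spectral_unit.
Qed.

(** S is unitary, hence preserves the norm. *)
Lemma spectral_norm (v : 'cV[R]_n) :
  toC (dot v v) = \sum_j `|(S *m cplx v) j 0| ^+ 2.
Proof.
have SV : S ^t* *m S = 1%:M.
  by rewrite -invmx_unitary ?spectral_unitarymx // mulVmx // spectral_unit.
have -> : toC (dot v v) = ((S *m cplx v) ^t* *m (S *m cplx v)) 0 0.
  rewrite trmx_mul map_mxM mulmxA -(mulmxA _ (S ^t*)) SV mulmx1.
  by rewrite -map_trmx conj_real_mx /dot map_trmx -map_mxM [RHS]mxE.
rewrite mxE; apply: eq_bigr => j _.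
by rewrite normCKC; congr (_ * _); rewrite 2!mxE.
Qed.

(** The j-th row of S is an eigenvector over the complex numbers. Real and complex
eigenvalues are compared through the characteristic polynomial, which is the
same over both fields. *)
Lemma spectral_diag_eigenvalue j :
  exists2 r : R, eigenvalue M r & d 0 j = toC r.
Proof.
have /mxOverP/(_ 0 j)/complex_realP [r dE] :=
  hermitian_spectral_diag_real symmetric_hermsymmx.
exists r => //; rewrite eigenvalue_root_char.
rewrite -(fmorph_root toC) map_char_poly -eigenvalue_root_char -/MC.
apply/eigenvalueP; exists (row j S).
  by rewrite -row_mul spectralE row_mul row_diag_mx -scalemxAl -rowE dE.
apply/negP => /eqP S0; have := spectral_unit MC; rewrite unitmxE -/S.
rewrite (expand_det_row _ j) big1 ?unitr0 // => k _.
by move/rowP/(_ k): S0; rewrite !mxE => ->; rewrite mul0r.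
Qed.

(** The vector M w stands for an arbitrary vector orthogonal to the kernel of M:
its spectral coordinates vanish wherever the eigenvalue does. In the other
coordinates the eigenvalue is at least a in absolute value. *)
Lemma spectral_gap (a : R) (w : 'cV[R]_n) : 0 <= a ->
  (forall r, eigenvalue M r -> r != 0 -> a <= `|r|) ->
  a ^+ 2 * dot (M *m w) (M *m w) <= dot (M *m (M *m w)) (M *m (M *m w)).
Proof.
move=> a_ge0 gap; rewrite -lecR rmorphM /= !spectral_norm mulr_sumr.
have SM (v : 'cV[R]_n) j : (S *m cplx (M *m v)) j 0 = d 0 j * (S *m cplx v) j 0.
  by rewrite map_mxM mulmxA spectralE -mulmxA mul_diag_mx mxE.
apply: ler_sum => j _; rewrite !SM.
have [r r_eig ->] := spectral_diag_eigenvalue j.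
rewrite [in X in _ <= X]normrM exprMn; have [->|r_neq0] := eqVneq r 0.
  by rewrite rmorph0 !mul0r normr0 expr0n mul0r mulr0.
apply: ler_wpM2r; first by rewrite exprn_ge0.
have -> : `|toC r| = toC `|r| by rewrite normc_def /= expr0n addr0 sqrtr_sqr.
rewrite -rmorphXn lecR ler_sqr ?nnegrE //; exact: gap.
Qed.

End Spectral.

(** * The graph Laplacian *)

Section Laplacian.
Variables (R : realType) (n : nat) (e : rel 'I_n).
Hypotheses (e_sym : symmetric e) (e_irr : irreflexive e).
Local Notation A := (laplacian e R).

Lemma laplacian_sym : A^T = A.
Proof.
apply/matrixP => i j; rewrite !mxE !inE (eq_sym j) (e_sym j).
by case: eqP => [->|].
Qed.

Lemma closed_nbr_self i : i \in closed_nbr e i.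
Proof. by rewrite inE eqxx. Qed.

Lemma degreeE i : degree e i = #|[set j | e i j]|.
Proof.
rewrite /degree (cardsD1 i (closed_nbr e i)) closed_nbr_self /=.
by apply: eq_card => j; rewrite !inE; case: eqP => [->|]; rewrite ?e_irr.
Qed.

Lemma card_closed_nbr i : #|closed_nbr e i| = (degree e i).+1.
Proof. by rewrite /degree (cardsD1 i) closed_nbr_self. Qed.

Lemma laplacian_off i j : j \notin closed_nbr e i -> A i j = 0.
Proof.
move=> ij; rewrite mxE (negPf ij).
by case: eqP ij => [->|]; rewrite ?closed_nbr_self.
Qed.

Lemma mul_laplacian (x : 'cV[R]_n) i :
  (A *m x) i 0 = \sum_(j in closed_nbr e i) A i j * x j 0.
Proof.
rewrite mxE [LHS](bigID [in closed_nbr e i]) /= [X in _ + X]big1 ?addr0 //.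
by move=> j /laplacian_off ->; rewrite mul0r.
Qed.

Lemma laplacianE (x : 'cV[R]_n) i :
  (A *m x) i 0 = \sum_(j | e i j) (x i 0 - x j 0).
Proof.
rewrite mul_laplacian (bigD1 i) ?closed_nbr_self //= mxE eqxx degreeE.
rewrite sumrB sumr_const mulr_natl; congr (_ *+ _ + _).
  by apply: eq_card => j; rewrite !inE.
rewrite -sumrN; apply: eq_big => [j|j /andP[jn /negPf ji]].
  by rewrite !inE; case: eqP => [->|]; rewrite ?e_irr ?andbT.
by rewrite mxE ji jn mulN1r.
Qed.

(** The sum runs over ordered pairs, so each edge is counted twice. *)
Lemma dot_laplacian (x : 'cV[R]_n) :
  dot x (A *m x) *+ 2 = \sum_i \sum_(j | e i j) (x i 0 - x j 0) ^+ 2.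
Proof.
have E : dot x (A *m x) = \sum_i \sum_(j | e i j) x i 0 * (x i 0 - x j 0).
  by rewrite dotE; apply: eq_bigr => i _; rewrite laplacianE mulr_sumr.
have E' : dot x (A *m x) = \sum_i \sum_(j | e i j) x j 0 * (x j 0 - x i 0).
  rewrite E (exchange_big_dep xpredT) //=; apply: eq_bigr => i _.
  by apply: eq_bigl => j; exact: e_sym.
rewrite mulr2n {1}E E' -big_split; apply: eq_bigr => i _ /=.
by rewrite -big_split; apply: eq_bigr => j _ /=; ring.
Qed.

Lemma laplacian_ge0 (x : 'cV[R]_n) : 0 <= dot x (A *m x).
Proof.
rewrite -(@pmulrn_lge0 _ _ 2) // dot_laplacian.
by do 2!apply: sumr_ge0 => ? _; exact: sqr_ge0.
Qed.

(** The quadratic form of the Laplacian vanishes only if x takes equal values at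
the two ends of each edge. *)
Lemma laplacian_ker (e_conn : graph_connected e) (x : 'cV[R]_n) :
  A *m x = 0 -> forall i j, x i 0 = x j 0.
Proof.
move=> Ax0; have /eqP := dot_laplacian x; rewrite Ax0 dot0r mul0rn eq_sym.
rewrite psumr_eq0 => [/allP H|i _]; last first.
  by apply: sumr_ge0 => j _; exact: sqr_ge0.
have step i j : e i j -> x i 0 = x j 0.
  move=> eij; have := H i (mem_index_enum i).
  rewrite psumr_eq0 => [/allP/(_ j (mem_index_enum j))|k _]; last exact: sqr_ge0.
  by rewrite eij /= sqrf_eq0 subr_eq0 => /eqP.
move=> i j; have /connectP[q] := e_conn i j.
elim: q i => [|k q IH] i /=; first by move=> _ ->.
by move=> /andP[/step -> /IH h] /h.
Qed.

Lemma laplacian_const (k : R) : A *m (const_mx k : 'cV[R]_n) = 0.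
Proof.
by apply/colP => i; rewrite laplacianE big1 ?mxE // => j _; rewrite !mxE subrr.
Qed.

(** The image of a symmetric matrix is the orthogonal of its kernel, here of the
constant vectors. *)
Lemma laplacian_image (e_conn : graph_connected e) (v : 'cV[R]_n) :
  \sum_i v i 0 = 0 -> exists w, A *m w = v.
Proof.
move=> v0; have : (v^T <= A)%MS.
  rewrite submxE; apply/eqP/rowP => j; rewrite [RHS]mxE.
  (* Each column of the cokernel matrix is in the kernel, hence constant, and so
     orthogonal to v. *)
  have K0 : A *m col j (cokermx A) = 0.
    by rewrite colE mulmxA mulmx_coker mul0mx.
  have Kc := laplacian_ker e_conn K0.
  rewrite mxE; under eq_bigr => i _.
    rewrite mxE (_ : cokermx A i j = cokermx A j j); last first.
      by have := Kc i j; rewrite !mxE.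
    over.
  by rewrite -mulr_suml v0 mul0r.
move=> /submxP[w wE]; exists w^T.
by rewrite -{1}laplacian_sym -trmx_mul -wE trmxK.
Qed.

Lemma algebraic_connectivity_gt0 (a : R) :
  is_algebraic_connectivity e a -> 0 < a.
Proof.
case=> /eigenvalueP[v vA v0] a0 _; rewrite lt_neqAle eq_sym a0 /=.
have := laplacian_ge0 v^T.
rewrite -{1}laplacian_sym -trmx_mul vA linearZ dotZr pmulr_lge0 // lt_neqAle.
rewrite dot_ge0 andbT eq_sym; apply: contraNN v0 => /eqP/dot_eq0.
by move=> /(congr1 trmx); rewrite trmxK trmx0 => ->.
Qed.

Lemma laplacian_gap (a : R) (w : 'cV[R]_n) : is_algebraic_connectivity e a ->
  a ^+ 2 * dot (A *m w) (A *m w) <= dot (A *m (A *m w)) (A *m (A *m w)).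
Proof.
move=> aP; apply: spectral_gap.
- exact: laplacian_sym.
- exact/ltW/algebraic_connectivity_gt0.
- by case: aP => _ _ aP r r_eig r0; apply: le_trans (ler_norm _); exact: aP.
Qed.

Lemma degree_le_max i : (degree e i <= max_degree e)%N.
Proof. exact: (@leq_bigmax _ (degree e)). Qed.

Lemma max_degree_gt0 (e_conn : graph_connected e) :
  (1 < n)%N -> (0 < max_degree e)%N.
Proof.
move=> n1; pose i0 := Ordinal (ltnW n1); pose i1 := Ordinal n1.
apply: leq_trans (degree_le_max i0).
have /connectP[[|k q] /=] := e_conn i0 i1; first by move=> _ /(congr1 val).
by move=> /andP[ek _] _; rewrite degreeE (cardD1 k) inE ek.
Qed.

Lemma sum_sqr_laplacian j :
  \sum_(i in closed_nbr e j) A i j ^+ 2 = (degree e j)%:R * (degree e j).+1%:R.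
Proof.
rewrite (bigD1 j) ?closed_nbr_self //= mxE eqxx.
rewrite (eq_bigr (fun=> 1)) => [|i /andP[ij /negPf ji]]; last first.
  by move: ij; rewrite mxE !inE (eq_sym j) ji e_sym /= => ->; rewrite sqrrN expr1n.
rewrite (eq_bigl [in [set i | e j i]]) => [|i]; last first.
  by rewrite !inE; case: eqP => [->|]; rewrite ?e_irr ?andbT.
rewrite sumr_const -degreeE.
by rewrite -natr1; ring.
Qed.

End Laplacian.

(** * The weighted matrices of the iteration *)

Section Weights.
Variables (R : realType) (n : nat) (e : rel 'I_n).
Hypotheses (e_sym : symmetric e) (e_irr : irreflexive e).
Local Notation A := (laplacian e R).
Local Notation Dinv := (invmx (degree_succ_mx e R)).
Local Notation B := (A^T *m Dinv *m A).

Lemma invmx_degree_succ :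
  Dinv = diag_mx (\row_i ((degree e i).+1%:R)^-1).
Proof.
set E := diag_mx _.
have DE : degree_succ_mx e R *m E = 1%:M.
  rewrite /degree_succ_mx mulmx_diag; apply/matrixP => i j; rewrite !mxE.
  by rewrite mulfV ?pnatr_eq0.
have [D_unit _] := mulmx1_unit DE.
by rewrite -[RHS]mul1mx -(mulVmx D_unit) -mulmxA DE mulmx1.
Qed.

Lemma local_averageE (x : 'cV[R]_n) i :
  local_average e x i = (Dinv *m (A *m x)) i 0.
Proof.
rewrite /local_average -mul_laplacian invmx_degree_succ mul_diag_mx [RHS]mxE.
by rewrite [X in _ = X * _]mxE.
Qed.

Lemma dot_weighted_laplacian (u v : 'cV[R]_n) :
  dot u (B *m v) =
    \sum_i ((degree e i).+1%:R)^-1 * ((A *m u) i 0 * (A *m v) i 0).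
Proof.
rewrite -!mulmxA dot_mulmxr trmxK dotE; apply: eq_bigr => i _.
by rewrite -local_averageE /local_average -mul_laplacian mulrCA.
Qed.

Definition degree_weight_mx : 'M[R]_n :=
  diag_mx (\row_i ((degree e i)%:R * (degree e i).+1%:R)).

(** The matrix W that penalizes x(t+1) - x(t): it compares the separable quadratic
term of the local problems with that of an exact augmented Lagrangian. *)
Definition prox_mx : 'M[R]_n := degree_weight_mx - B.

Lemma degree_weight_mulE (v : 'cV[R]_n) i :
  (degree_weight_mx *m v) i 0 = (degree e i)%:R * (degree e i).+1%:R * v i 0.
Proof. by rewrite mul_diag_mx [LHS]mxE mxE. Qed.

Lemma weighted_laplacian_sym : B^T = B.
Proof. by rewrite !trmx_mul trmxK invmx_degree_succ tr_diag_mx mulmxA. Qed.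

Lemma prox_mx_sym : prox_mx^T = prox_mx.
Proof. by rewrite /prox_mx linearB /= weighted_laplacian_sym tr_diag_mx. Qed.

(** The variance of the z i is nonnegative. *)
Lemma sqr_sum_le_card (I : finType) (P : pred I) (z : I -> R) :
  (\sum_(i in P) z i) ^+ 2 <= #|P|%:R * \sum_(i in P) z i ^+ 2.
Proof.
set S := \sum_(i in P) z i; set S2 := \sum_(i in P) z i ^+ 2.
have [P0|P0] := posnP #|P|.
  rewrite P0 mul0r /S big1 ?expr0n // => i iP.
  by have := card0_eq P0 i; rewrite iP.
have P_gt0 : 0 < #|P|%:R :> R by rewrite ltr0n.
have : 0 <= \sum_(i in P) (z i - S / #|P|%:R) ^+ 2.
  by apply: sumr_ge0 => i _; exact: sqr_ge0.
have -> : \sum_(i in P) (z i - S / #|P|%:R) ^+ 2 = S2 - S ^+ 2 / #|P|%:R.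
  under eq_bigr => i _ do rewrite sqrrB.
  rewrite big_split sumrB /= -/S2 sumr_const -mulr_natr sumrMnl -mulr_suml -/S.
  by field; rewrite gt_eqF.
by rewrite subr_ge0 ler_pdivrMr // mulrC.
Qed.

(** The factor 1 / (d_i + 1) in B absorbs the number of terms of the i-th entry of
A v, which leaves the sum of the squares of the A_ij v_j; exchanging the sums
gives the quadratic form of the diagonal part. *)
Lemma prox_mx_ge0 (v : 'cV[R]_n) : 0 <= dot v (prox_mx *m v).
Proof.
rewrite mulmxBl dotDr dotNr subr_ge0 dot_weighted_laplacian dotE.
apply: (@le_trans _ _ (\sum_i \sum_(j in closed_nbr e i) (A i j * v j 0) ^+ 2)).
  apply: ler_sum => i _; rewrite mulrC ler_pdivrMr // -expr2 mul_laplacian.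
  by rewrite mulrC -card_closed_nbr; exact: sqr_sum_le_card.
rewrite (exchange_big_dep xpredT) //=; apply: ler_sum => j _.
rewrite degree_weight_mulE -sum_sqr_laplacian // mulrCA -expr2.
rewrite mulr_suml le_eqVlt; apply/orP; left; apply/eqP.
apply: eq_big => [i|i _]; last by rewrite exprMn.
by rewrite !inE eq_sym e_sym.
Qed.

(** On the kernel of A only the diagonal part remains, and d (d + 1) <= 2 m^2 for
d <= m as soon as m is positive. *)
Lemma prox_mx_le (v : 'cV[R]_n) : (0 < max_degree e)%N -> A *m v = 0 ->
  dot v (prox_mx *m v) <= dot v v * (2 * (max_degree e)%:R ^+ 2).
Proof.
move=> d_gt0 Av0; rewrite mulmxBl -!mulmxA Av0 !mulmx0 subr0 !dotE mulr_suml.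
apply: ler_sum => i _; rewrite degree_weight_mulE mulrCA [X in _ <= X]mulrC.
apply: ler_wpM2r; first by rewrite -expr2 sqr_ge0.
rewrite -natrM -natrX -natrM ler_nat.
have := degree_le_max e i; move: (degree e i) (max_degree e) d_gt0 => d m m0 dm.
by rewrite mulnC expnS expn1 mulnA leq_mul // mul2n -addnn -addn1 leq_add.
Qed.

End Weights.

(** * Decrease of the Lyapunov function *)

Lemma subdifferential_dot (R : realType) (n : nat) (f : 'I_n -> R -> R)
    (u v w : 'cV[R]_n) :
  objective_subdifferential f u v ->
  objective f u + dot v (w - u) <= objective f w.
Proof.
move=> uv; rewrite dotE /objective -big_split; apply: ler_sum => i _ /=.
by have := uv i (w i 0); rewrite !mxE.
Qed.

(** Jensen's inequality: a subgradient at the average, which exists by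
convexity, supports all the iterates at once. *)
Lemma objective_ergodic_average (R : realType) (n : nat) (f : 'I_n -> R -> R)
    (x : nat -> 'cV[R]_n) (T : nat) :
  (forall i, convex_on_line (f i)) -> (0 < T)%N ->
  T%:R * objective f (ergodic_average x T) <= \sum_(t < T) objective f (x t.+1).
Proof.
move=> f_cvx T0; set xh := ergodic_average x T.
have T_neq0 : T%:R != 0 :> R by rewrite pnatr_eq0 -lt0n.
have xhE : T%:R *: xh = \sum_(t < T) x t.+1.
  by rewrite scalerA mulfV // scale1r big_add1 big_mkord.
have /boolp.choice[h hP] : forall i, exists h, subdifferential (f i) (xh i 0) h.
  move=> i; have [h] := right_derivative_subgradient (xh i 0) (f_cvx i).
  by exists h.
have xhP : objective_subdifferential f xh (\col_i h i).
  by move=> i; rewrite mxE.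
have := ler_sum (index_enum 'I_T) (fun t _ => subdifferential_dot (x t.+1) xhP).
move=> /(_ xpredT) H; apply: le_trans H.
rewrite big_split /= sumr_const card_ord mulr_natl lerDl.
rewrite le_eqVlt; apply/orP; left; apply/eqP.
transitivity (dot (\col_i h i) (\sum_(t < T) x t.+1 - T%:R *: xh)).
  by rewrite xhE subrr dot0r.
rewrite scaler_nat -[T in _ *+ T]card_ord -sumr_const -sumrB.
by rewrite /dot mulmx_sumr summxE.
Qed.

(** An abstract proximal iteration, in which Q is symmetric, W symmetric
positive semidefinite, Q X t is the current multiplier, and x is driven by the subgradient
inclusion [step]. *)
Section Telescoping.
Variables (R : realType) (n : nat) (f : 'I_n -> R -> R) (c : R).
Variables (Q W : 'M[R]_n) (x : nat -> 'cV[R]_n) (xs : 'cV[R]_n).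
Hypothesis f_cvx : forall i, convex_on_line (f i).
Hypotheses (c_gt0 : 0 < c) (Q_sym : Q^T = Q) (W_sym : W^T = W).
Hypothesis W_ge0 : forall v : 'cV[R]_n, 0 <= dot v (W *m v).
Hypotheses (x0 : x 0%N = 0) (Qxs : Q *m xs = 0).

Local Notation X t := (\sum_(s < t.+1) x s).

Hypothesis step : forall t, objective_subdifferential f (x t.+1)
  (- (c *: (Q *m (Q *m X t.+1) + W *m (x t.+1 - x t)))).

(** Expanding the squares, the two sides differ by the subgradient inequality at
x (t + 1) and by c / 2 times |Q x (t + 1)|^2 + |x (t + 1) - x t|_W^2. *)
Lemma lyapunov_step (r : 'cV[R]_n) t :
  objective f (x t.+1) - objective f xs + c * dot r (Q *m x t.+1) <=
  c / 2 * (dot (Q *m X t - r) (Q *m X t - r)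
           - dot (Q *m X t.+1 - r) (Q *m X t.+1 - r)
           + dot (x t - xs) (W *m (x t - xs))
           - dot (x t.+1 - xs) (W *m (x t.+1 - xs))).
Proof.
set ro := Q *m X t; set de := Q *m x t.+1.
set a := x t.+1 - xs; set b := x t - xs.
have QX : Q *m X t.+1 = ro + de by rewrite -mulmxDr [in LHS]big_ord_recr.
have xB : x t.+1 - x t = a - b by rewrite /a opprB addrA subrK.
have Qa : Q *m a = de by rewrite mulmxBr Qxs subr0.
have := subdifferential_dot xs (step t).
rewrite QX xB -(opprB _ xs) -/a dotNl dotNr opprK dotZl dotDl.
rewrite -[in dot (Q *m _) _]Q_sym -[in dot (W *m _) _]W_sym -!dot_mulmxr Qa.
have ba : dot b (W *m a) = dot a (W *m b) by rewrite dot_mulmxr W_sym dotC.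
have := dot_ge0 de; have := W_ge0 (a - b); rewrite mulmxBr.
clearbody a b ro de.
rewrite !(dotDl, dotDr, dotNl, dotNr) ba (dotC de ro) (dotC r ro) (dotC de r).
move: (dot a _) (dot a _) (dot b _) (dot ro ro) => waa wab wbb dd ab0 de0 H.
have := mulr_ge0 (ltW c_gt0) ab0; have := mulr_ge0 (ltW c_gt0) de0.
by move=> cde cab; lra.
Qed.

(** The sum telescopes. As x 0 = 0, the Lyapunov function starts at
|r|^2 + |xs|_W^2. *)
Lemma lyapunov_sum (r : 'cV[R]_n) T :
  \sum_(t < T) (objective f (x t.+1) - objective f xs + c * dot r (Q *m x t.+1))
  <= c / 2 * (dot r r + dot xs (W *m xs)).
Proof.
set P := dot r r + _.
suff : \sum_(t < T)
    (objective f (x t.+1) - objective f xs + c * dot r (Q *m x t.+1))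
  <= c / 2 * (P - dot (Q *m X T - r) (Q *m X T - r)
              - dot (x T - xs) (W *m (x T - xs))).
  move/le_trans; apply.
  rewrite ler_pM2l ?divr_gt0 // -addrA gerDl -opprD oppr_le0.
  by rewrite addr_ge0 ?dot_ge0.
elim: T => [|T IH]; last first.
  by rewrite big_ord_recr /=; have := lyapunov_step r T; lra.
rewrite big_ord0 big_ord1 x0 mulmx0 !sub0r mulmxN !dotNl !dotNr !opprK /P.
by rewrite -addrA -opprD subrr mulr0.
Qed.

Lemma ergodic_gap (r : 'cV[R]_n) (T : nat) : (0 < T)%N ->
  objective f (ergodic_average x T) - objective f xs
    + c * dot r (Q *m ergodic_average x T)
  <= c / (2 * T%:R) * (dot r r + dot xs (W *m xs)).
Proof.
move=> T0; have TR0 : 0 < T%:R :> R by rewrite ltr0n.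
have -> : c / (2 * T%:R) * (dot r r + dot xs (W *m xs)) =
  c / 2 * (dot r r + dot xs (W *m xs)) / T%:R by field; rewrite gt_eqF.
rewrite ler_pdivlMr //.
apply: le_trans (lyapunov_sum r T).
rewrite big_split sumrB /= sumr_const card_ord -mulr_sumr.
have -> : \sum_(t < T) dot r (Q *m x t.+1) =
    T%:R * dot r (Q *m ergodic_average x T).
  rewrite -dotZr scalemxAr scalerA mulfV ?gt_eqF // scale1r big_add1 big_mkord.
  by rewrite mulmx_sumr /dot mulmx_sumr summxE.
have := objective_ergodic_average x f_cvx T0; rewrite -mulr_natr; lra.
Qed.

(** The subgradient inequality at xs; since Q xs = 0 and Q is symmetric, the
linear term depends on Q z only. *)
Lemma saddle_lower (r z : 'cV[R]_n) :
  objective_subdifferential f xs (- (c *: (Q *m r))) ->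
  0 <= objective f z - objective f xs + c * dot r (Q *m z).
Proof.
move=> /(subdifferential_dot z).
rewrite dotNl dotZl -[in Q *m r]Q_sym -dot_mulmxr mulmxBr Qxs subr0; lra.
Qed.

End Telescoping.

(** * The iterates and the multiplier *)

Section Run.
Variables (R : realType) (n : nat) (e : rel 'I_n) (f : 'I_n -> R -> R) (c : R).
Hypotheses (e_sym : symmetric e) (e_irr : irreflexive e).
Hypothesis f_cvx : forall i, convex_on_line (f i).
Local Notation A := (laplacian e R).
Local Notation Dinv := (invmx (degree_succ_mx e R)).
Local Notation B := (A^T *m Dinv *m A).

(** The slope at the new point of the quadratic part of the i-th local problem.
The second-order coefficients of that part are what makes the degree weights
d_i (d_i + 1) appear. *)
Lemma local_lagrangian_argmin (xt yt pt xn : 'cV[R]_n) :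
  (forall i, argmin (local_lagrangian e f c xt yt pt i) (xn i 0)) ->
  objective_subdifferential f xn
    (- (A^T *m (pt + c *: yt) + c *: (degree_weight_mx R e *m (xn - xt)))).
Proof.
move=> xn_min i; rewrite [X in subdifferential _ _ X]mxE.
pose q w := \sum_(j in closed_nbr e i)
  (pt j 0 * A j i * w + c / 2 * `|yt j 0 + A j i * (w - xt i 0)| ^+ 2).
set b : R := (X in - X).
have Aij j : A i j = A j i by rewrite -[in LHS]laplacian_sym // mxE.
have dE : (xn - xt) i 0 = xn i 0 - xt i 0 by rewrite !mxE.
have bE : b = \sum_(j in closed_nbr e i)
    (pt j 0 * A j i + c * A j i * (yt j 0 + A j i * (xn i 0 - xt i 0))).
  rewrite /b laplacian_sym // mxE mul_laplacian [X in _ + X]mxE degree_weight_mulE.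
  rewrite -sum_sqr_laplacian // mulr_suml mulr_sumr -big_split dE.
  apply: eq_bigr => j _ /=; rewrite Aij.
  have -> : (pt + c *: yt) j 0 = pt j 0 + c * yt j 0 by rewrite !mxE.
  by ring.
apply: (@subdifferential_of_argmin _ (f i) q _ b
  (\sum_(j in closed_nbr e i) c / 2 * A j i ^+ 2) (f_cvx i))
  => [w|]; last exact: xn_min.
rewrite bE /q !mulr_suml -!big_split /=; apply: eq_bigr => j _.
by rewrite !real_normK ?num_real //; field.
Qed.

Variables (x y p : nat -> 'cV[R]_n).
Hypothesis run : admm_run e f c x y p.

Lemma run_y t : y t = Dinv *m (A *m x t).
Proof.
apply/colP => i; rewrite -local_averageE.
by case: t => [|t]; [exact: admm_y0 run i | exact: admm_y run t i].
Qed.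

(** The multiplier p accumulates the averages y, starting from p 0 = c y 0. *)
Lemma run_p t : p t = c *: (Dinv *m (A *m \sum_(s < t.+1) x s)).
Proof.
elim: t => [|t IH].
  by rewrite big_ord1 -run_y; apply/colP => i; rewrite mxE (admm_p0 run).
rewrite big_ord_recr /= !mulmxDr scalerDr -IH -run_y.
by apply/colP => i; rewrite (admm_p run) !mxE.
Qed.

(** The optimality condition of the x-update contains p t + c y t in place of
p (t + 1) = p t + c y (t + 1). The difference is c B (x (t + 1) - x t) after
multiplication by A', and is subtracted from the degree weights to form the
proximal matrix. *)
Lemma run_subgradient t :
  objective_subdifferential f (x t.+1)
    (- (c *: (B *m (\sum_(s < t.+2) x s) + prox_mx R e *m (x t.+1 - x t)))).
Proof.
have := local_lagrangian_argmin (admm_x run t).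
suff -> : A^T *m (p t + c *: y t)
    + c *: (degree_weight_mx R e *m (x t.+1 - x t)) =
  c *: (B *m (\sum_(s < t.+2) x s) + prox_mx R e *m (x t.+1 - x t)) by [].
rewrite run_p run_y -scalerDr -scalemxAr -scalerDr; congr (_ *: _).
rewrite -!mulmxDr !mulmxA [in RHS]mulmxBl [in RHS]addrA [in RHS]addrAC.
rewrite -mulmxBr; congr (_ *m _ + _).
by rewrite [in RHS]big_ord_recr /= opprB addrA [in RHS]addrAC addrK.
Qed.

End Run.

Section Dual.
Variables (R : realType) (n : nat) (e : rel 'I_n).
Hypotheses (e_sym : symmetric e) (e_irr : irreflexive e).
Hypothesis e_conn : graph_connected e.
Local Notation A := (laplacian e R).
Local Notation Dinv := (invmx (degree_succ_mx e R)).
Local Notation B := (A^T *m Dinv *m A).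

(** The feasible vectors are the constant ones, so optimality is a minimization
over the line, to which the sum rule applies. *)
Lemma optimal_subgradient (f : 'I_n -> R -> R) (xs : 'cV[R]_n) :
  (forall i, convex_on_line (f i)) -> (0 < n)%N -> is_optimal f A xs ->
  exists2 v, objective_subdifferential f xs v & \sum_i v i 0 = 0.
Proof.
move=> f_cvx n_gt0 [Axs xs_min]; pose i0 := Ordinal n_gt0.
have xsE i : xs i 0 = xs i0 0 by exact: laplacian_ker Axs i i0.
have [|h hP h0] := @subdifferential_sum_rule R 'I_n f (xs i0 0) f_cvx.
  move=> w; have := xs_min (const_mx w) (laplacian_const e_irr w).
  rewrite /objective; under eq_bigr do rewrite xsE.
  by under [X in _ <= X -> _]eq_bigr do rewrite mxE.
exists (\col_i h i); first by move=> i; rewrite mxE xsE.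
by rewrite -[RHS]h0; apply: eq_bigr => i _; rewrite mxE.
Qed.

(** Solve A s = v with s in the image of A, so that a |s| <= |v|. Then solve
A u = D (s + k 1), where the shift k gives the right-hand side sum zero; as A
kills constants, B u = A (s + k 1) = v. For this k the form u' B u is at most
s' D s, and D is at most 2 d_max. *)
Lemma weighted_laplacian_preimage (a : R) (v : 'cV[R]_n) : (1 < n)%N ->
  is_algebraic_connectivity e a -> \sum_i v i 0 = 0 ->
  exists2 u, B *m u = v &
    dot u (B *m u) <= dot v v * (2 * (max_degree e)%:R / a ^+ 2).
Proof.
move=> n1 aP v0; have n_gt0 := ltnW n1.
have a_gt0 := algebraic_connectivity_gt0 e_sym e_irr aP.
have [s0 As0] := laplacian_image e_sym e_irr e_conn v0.
pose m := (\sum_i s0 i 0) / n%:R.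
have [w Aw] : exists w, A *m w = s0 - const_mx m.
  apply: laplacian_image => //.
  under eq_bigr do rewrite !mxE.
  by rewrite sumrB sumr_const card_ord -mulr_natr divfK ?subrr // pnatr_eq0 -lt0n.
pose s := A *m w.
have As : A *m s = v by rewrite /s Aw mulmxBr laplacian_const // subr0.
have s_le : a ^+ 2 * dot s s <= dot v v by rewrite -As; exact: laplacian_gap.
pose d i : R := (degree e i).+1%:R.
have d_gt0 i : 0 < d i by rewrite ltr0n.
have sd_gt0 : 0 < \sum_i d i.
  by rewrite (bigD1 (Ordinal n_gt0)) //= ltr_pwDl // sumr_ge0.
pose k := - (\sum_i d i * s i 0) / \sum_i d i.
have [u Au] : exists u, A *m u = \col_i (d i * (s i 0 + k)).
  apply: laplacian_image => //.
  under eq_bigr do rewrite mxE mulrDr.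
  by rewrite big_split /= -mulr_suml /k mulrCA mulfV ?gt_eqF // mulr1 subrr.
have Bu : B *m u = v.
  rewrite -!mulmxA Au laplacian_sym // (_ : Dinv *m _ = s + const_mx k).
    by rewrite mulmxDr laplacian_const // addr0.
  apply/colP => i; rewrite invmx_degree_succ mul_diag_mx !mxE.
  by rewrite mulrA mulVf ?mul1r // gt_eqF.
exists u => //; rewrite Bu -[X in dot u X]As dot_mulmxr laplacian_sym // Au dotE.
apply: (@le_trans _ _ (\sum_i d i * s i 0 ^+ 2)).
  have -> : \sum_i (\col_i0 (d i0 * (s i0 0 + k))) i 0 * s i 0 =
      \sum_i d i * s i 0 ^+ 2 + k * \sum_i d i * s i 0.
    by rewrite mulr_sumr -big_split; apply: eq_bigr => i _ /=; rewrite mxE; ring.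
  rewrite gerDl /k mulrAC mulNr -expr2 mulNr oppr_le0.
  by rewrite divr_ge0 ?sqr_ge0 // ltW.
apply: (@le_trans _ _ (2 * (max_degree e)%:R * dot s s)).
  rewrite dotE mulr_sumr; apply: ler_sum => i _.
  rewrite -expr2 ler_wpM2r ?sqr_ge0 // /d -natrM ler_nat mul2n -addnn -addn1.
  by rewrite leq_add ?degree_le_max // max_degree_gt0.
rewrite mulrA [X in _ <= X / _]mulrC -[X in _ <= X]mulrA.
by rewrite ler_wpM2l ?mulr_ge0 // ler_pdivlMr ?exprn_gt0 // mulrC.
Qed.

End Dual.

(** * Convergence rates *)

(** Here phi is the objective gap, z the residual Q xhat, and rho bounds the
square of the norm of the multiplier r. The upper bound is used at 0, at 2 r,
and at r plus the unit vector in the direction of z. *)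
Lemma saddle_rates (R : realType) (n : nat) (phi k c rho w : R)
    (r z : 'cV[R]_n) :
  0 < c -> 0 < k -> dot r r <= rho ->
  (forall r', phi + c * dot r' z <= c * k * (dot r' r' + w)) ->
  0 <= phi + c * dot r z ->
  `|phi| <= c * k * (w + 4 * rho) /\ l2norm z <= k * (w + 2 + 2 * rho).
Proof.
move=> c0 k0 r_le upper lower.
have rho0 : 0 <= rho by apply: le_trans r_le; exact: dot_ge0.
have ck0 : 0 < c * k by rewrite mulr_gt0.
split.
  rewrite ler_norml; apply/andP; split.
    have := upper (2 *: r); rewrite !dotZl !dotZr.
    have : c * k * (2 * (2 * dot r r) + w) <= c * k * (w + 4 * rho).
      by rewrite ler_pM2l //; lra.
    by move: lower; lra.
  have := upper 0; rewrite !dot0l mulr0 addr0 add0r.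
  by move=> /le_trans; apply; rewrite ler_pM2l //; lra.
have [z0|z_neq0] := eqVneq (l2norm z) 0.
  rewrite z0.
  have : 0 <= c * k * (dot r r + w) by exact: le_trans lower (upper r).
  by rewrite !pmulr_rge0 //; lra.
have z_gt0 : 0 < l2norm z by rewrite lt_neqAle eq_sym z_neq0 l2norm_ge0.
pose u := (l2norm z)^-1 *: z.
have uz : dot u z = l2norm z.
  by rewrite dotZl -l2norm_sqr expr2 mulrA mulVf ?mul1r.
have uu : dot u u = 1 by rewrite {2}/u dotZr uz mulVf.
have ru : dot (r + u) (r + u) <= 2 * rho + 2.
  have := dot_ge0 (r - u).
  rewrite !(dotDl, dotDr, dotNl, dotNr) uu (dotC u r) => H; lra.
have := upper (r + u); rewrite dotDl uz => H.
have H2 : c * l2norm z <= c * k * (dot (r + u) (r + u) + w) by lra.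
rewrite -(ler_pM2l c0) mulrA; apply: le_trans H2 _.
by rewrite ler_pM2l //; lra.
Qed.

Theorem proposition3 (R : realType) (n : nat) (e : rel 'I_n)
    (f : 'I_n -> R -> R) (c : R) (x y p : nat -> 'cV[R]_n)
    (xstar : 'cV[R]_n) (U aG : R) (Q : 'M[R]_n)
    (n_ge2 : (2 <= n)%N)
    (e_sym : symmetric e) (e_irr : irreflexive e) (e_conn : graph_connected e)
    (f_convex : forall i, convex_on_line (f i))
    (xstar_opt : is_optimal f (laplacian e R) xstar)
    (c_gt0 : 0 < c)
    (run : admm_run e f c x y p)
    (x0 : x 0%N = 0)
    (U_bound : forall v : 'cV[R]_n,
       objective_subdifferential f xstar v -> l2norm v <= U)
    (aG_def : is_algebraic_connectivity e aG)
    (Q_def : is_psd_sqrt Q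
       ((laplacian e R)^T *m invmx (degree_succ_mx e R) *m laplacian e R)) :
  forall T : nat, (1 <= T)%N ->
    `|objective f (ergodic_average x T) - objective f xstar|
      <= c / (2 * T%:R) * l2norm xstar ^+ 2 * (4 * (max_degree e)%:R ^+ 2)
         + 2 / (c * T%:R) * U ^+ 2 * (2 * (max_degree e)%:R / aG ^+ 2)
    /\
    l2norm (Q *m ergodic_average x T)
      <= 1 / (2 * T%:R) * l2norm xstar ^+ 2 * (4 * (max_degree e)%:R ^+ 2)
         + 1 / (2 * T%:R)
           * (2 + 2 * U ^+ 2 / c ^+ 2 * (2 * (max_degree e)%:R / aG ^+ 2)).
Proof.
move=> T T_gt0; have TR0 : 0 < T%:R :> R by rewrite ltr0n.
have [[Q_sym _] QQ] := Q_def.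
have dmax_gt0 := max_degree_gt0 e_irr e_conn n_ge2.
have Axs := xstar_opt.1.
have Qxs : Q *m xstar = 0.
  apply: dot_eq0; rewrite -[in X in dot X _]Q_sym -dot_mulmxr mulmxA QQ.
  by rewrite -!mulmxA Axs !mulmx0 dot0r.
have [v v_sub v_sum0] :=
  optimal_subgradient e_sym e_irr e_conn f_convex (ltnW n_ge2) xstar_opt.
have [u Bu u_le] :=
  weighted_laplacian_preimage e_sym e_irr e_conn n_ge2 aG_def v_sum0.
pose r := - c^-1 *: (Q *m u).
set K := 2 * (max_degree e)%:R / aG ^+ 2.
have K_ge0 : 0 <= K by rewrite divr_ge0 ?sqr_ge0 // mulr_ge0.
have v_le : dot v v <= U ^+ 2.
  rewrite -l2norm_sqr ler_sqr ?nnegrE ?l2norm_ge0 ?U_bound //.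
  by apply: le_trans (U_bound _ v_sub); exact: l2norm_ge0.
have r_le : dot r r <= U ^+ 2 * K / c ^+ 2.
  rewrite dotZl dotZr dot_mulmxr Q_sym mulmxA QQ Bu.
  have -> : - c^-1 * (- c^-1 * dot v u) = dot v u / c ^+ 2.
    by field; rewrite gt_eqF.
  rewrite ler_pM2r ?invr_gt0 ?exprn_gt0 // dotC.
  by move: u_le; rewrite Bu => /le_trans; apply; rewrite ler_wpM2r.
have r_sub : objective_subdifferential f xstar (- (c *: (Q *m r))).
  suff -> : - (c *: (Q *m r)) = v by [].
  rewrite -scalemxAr scalerA mulmxA QQ Bu mulrN mulfV ?gt_eqF //.
  by rewrite scaleN1r opprK.
have step t : objective_subdifferential f (x t.+1)
    (- (c *: (Q *m (Q *m (\sum_(s < t.+2) x s)) + prox_mx R e *m (x t.+1 - x t)))).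
  by rewrite mulmxA QQ; exact: run_subgradient run t.
have upper r' := ergodic_gap f_convex c_gt0 Q_sym (prox_mx_sym R e)
  (@prox_mx_ge0 R n e e_sym e_irr) x0 Qxs step r' T_gt0.
have lower := saddle_lower Q_sym Qxs (ergodic_average x T) r_sub.
have W_le := prox_mx_le dmax_gt0 Axs.
set w := dot xstar _ in W_le upper; rewrite -l2norm_sqr in W_le.
set N := l2norm xstar ^+ 2 in W_le *.
have k_gt0 : 0 < 1 / (2 * T%:R) :> R by rewrite divr_gt0 ?mulr_gt0.
have [|obj_le res_le] := @saddle_rates R n _ (1 / (2 * T%:R)) c _ w r _
  c_gt0 k_gt0 r_le _ lower.
  by move=> r'; rewrite mulrA mulr1; exact: upper.
have w_le : w <= N * (4 * (max_degree e)%:R ^+ 2).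
  apply: le_trans W_le _; rewrite ler_wpM2l ?sqr_ge0 //.
  by rewrite ler_wpM2r ?sqr_ge0 // ler_nat.
split.
  apply: le_trans obj_le _.
  have -> : c / (2 * T%:R) * N * (4 * (max_degree e)%:R ^+ 2)
      + 2 / (c * T%:R) * U ^+ 2 * K =
    c * (1 / (2 * T%:R))
      * (N * (4 * (max_degree e)%:R ^+ 2) + 4 * (U ^+ 2 * K / c ^+ 2)).
    by field; rewrite !gt_eqF.
  by rewrite ler_pM2l ?(mulr_gt0 c_gt0 k_gt0) // lerD2r.
apply: le_trans res_le _.
rewrite -[X in _ <= X + _]mulrA -[X in _ <= X]mulrDr ler_pM2l //.
have -> : 2 * U ^+ 2 / c ^+ 2 * K = 2 * (U ^+ 2 * K / c ^+ 2).
  by field; rewrite gt_eqF.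
by lra.
Qed.
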